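(* Let $\mathcal S$ be an irreducible c.s.r. semigroup of real $3\times3$ matrices whose minimal rank of elements is $r=1$. Then, up to a linear similarity (replacing all $A\in\mathcal S$ by $T^{-1}AT$ with one invertible real matrix $T$), $\mathcal S$ either consists of $(1,3)$-matrices, or consists of transposes of $(1,3)$-matrices.
   Context: Matrix semigroups are multiplicative and, as assumed in the paper, topologically closed. A matrix semigroup is c.s.r. (has constant spectral radius) if the spectral radius (maximal modulus of eigenvalues) of all its elements is the same and nonzero. A family of $d\times d$ matrices is irreducible if there is no proper linear subspace of $\mathbb R^d$ (different from $\{0\}$ and $\mathbb R^d$) invariant for all its matrices. A $(1,3)$-matrix is a $3\times3$ matrix that has, in each row, a unique nonzero element, equal to $1$ or $-1$, all other elements being zero. *)

(* Defs.v *)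
(* Built on MathComp and MathComp-Analysis; R[i] comes from real-closed. *)
From HB Require Import structures.
From mathcomp Require Import all_boot all_order all_algebra.
From mathcomp Require Import complex.
From mathcomp Require Import all_classical all_reals all_analysis.

Set Implicit Arguments.
Unset Strict Implicit.
Unset Printing Implicit Defensive.

Import Order.TTheory GRing.Theory Num.Theory.
Import numFieldNormedType.Exports.

Local Open Scope classical_set_scope.
Local Open Scope ring_scope.

(* Eigenvalues are the complex ones.  For [0 < d] the set below is finite and
   nonempty, so its supremum is a maximum. *)
Definition spectral_radius (R : realType) (d : nat) (A : 'M[R]_d) : R :=
  sup [set ComplexField.Normc.normc z
      | z in [set z : R[i] | eigenvalue (map_mx (real_complex R) A) z]].

(* [closed] refers to the usual (entrywise) topology of ['M[R]_d]. *)
Definition matrix_semigroup (R : realType) (d : nat) (S : set 'M[R]_d) : Prop :=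
  closed S /\ (forall A B, S A -> S B -> S (A *m B)).

Definition constant_spectral_radius (R : realType) (d : nat)
    (S : set 'M[R]_d) : Prop :=
  exists2 r : R, r != 0 & forall A, S A -> spectral_radius A = r.

Definition irreducible_family (R : realType) (d : nat)
    (S : set 'M[R]_d) : Prop :=
  forall U : {vspace 'cV[R]_d},
    (forall A v, S A -> v \in U -> A *m v \in U) ->
    U = 0%VS \/ U = fullv.

Definition minimal_rank (R : realType) (d : nat) (S : set 'M[R]_d)
    (r : nat) : Prop :=
  (exists2 A, S A & \rank A = r) /\ (forall A, S A -> (r <= \rank A)%N).

Definition one_three_matrix (R : realType) (A : 'M[R]_3) : Prop :=
  forall i, exists2 j, A i j = 1 \/ A i j = - 1 & forall k, k != j -> A i k = 0.

(* Main.v *)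
(* Since the spectral radius of A^2 is the square of that of A, it equals 1,
   and a rank-one element x y has spectral radius |y x|.  Fix a rank-one
   element x0 y0 of S and let X = {x | x y0 in S} and Y = {y | x0 y in S}.  Then
   |y x| = 1 for all x in X and y in Y, S maps X into itself on the left and Y
   into itself on the right, and by irreducibility both sets span.  In
   coordinates dual to a basis contained in X, the elements of Y are sign
   vectors, which fall into four classes up to sign.  If Y meets only three of
   them, then S sends the elements of a basis contained in Y to signed basis
   elements; otherwise every x in X pairs to +1 or -1 with all sign vectors,
   hence is up to sign an element of the chosen basis. *)
Require Import Defs.
From HB Require Import structures.
From mathcomp Require Import all_boot all_order all_algebra.
From mathcomp Require Import complex.
From mathcomp Require Import all_classical all_reals all_analysis.
From mathcomp Require Import lra.

Set Implicit Arguments.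
Unset Strict Implicit.
Unset Printing Implicit Defensive.

Import Order.TTheory GRing.Theory Num.Theory.
Import numFieldNormedType.Exports.

Local Open Scope classical_set_scope.
Local Open Scope ring_scope.

(** * Rank-one matrices [x *m y] and their spectral radius *)

Lemma mulmx_rank1 (F : fieldType) (m n : nat) (A : 'M[F]_(m, n)) :
  \rank A = 1%N -> exists (x : 'cV[F]_m) (y : 'rV[F]_n), A = x *m y.
Proof.
move=> rkA; have := mulmx_base A.
by move: (col_base A) (row_base A); rewrite rkA => x y <-; exists x, y.
Qed.

Lemma mulmx11 (F : fieldType) (m : nat) (x : 'cV[F]_m) (a : 'M[F]_1) :
  x *m a = a 0 0 *: x.
Proof. by rewrite {1}[a]mx11_scalar mul_mx_scalar. Qed.

Lemma mul11mx (F : fieldType) (n : nat) (y : 'rV[F]_n) (a : 'M[F]_1) :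
  a *m y = a 0 0 *: y.
Proof. by rewrite {1}[a]mx11_scalar mul_scalar_mx. Qed.

Lemma mulmx_cVrV_cVrV (F : fieldType) (m n p : nat) (x : 'cV[F]_m)
    (y : 'rV[F]_n) (x' : 'cV[F]_n) (y' : 'rV[F]_p) :
  (x *m y) *m (x' *m y') = (((y *m x') 0 0) *: x) *m y'.
Proof.
by rewrite mulmxA -(mulmxA x) mulmx11.
Qed.

Lemma eigenvalue_cVrV (F : fieldType) (n : nat) (x : 'cV[F]_n.+2)
    (y : 'rV[F]_n.+2) : eigenvalue (x *m y) ((y *m x) 0 0).
Proof.
have [yx0|yx_neq0] := eqVneq ((y *m x) 0 0) 0; last first.
  apply/eigenvalueP; exists y.
    by rewrite mulmxA mul11mx.
  by apply: contraNneq yx_neq0 => ->; rewrite mul0mx mxE.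
(* The eigenvalue 0 needs a nonzero kernel, which exists because the rank is at most 1 while the
   size is at least 2. *)
rewrite yx0 /eigenvalue /eigenspace raddf0 subr0 -mxrank_eq0 mxrank_ker.
rewrite subn_eq0 -ltnNge ltnS.
by apply: leq_trans (mxrankM_maxr _ _) (leq_trans (rank_leq_row _) _).
Qed.

(** If [v] is a left eigenvector, then [(v *m x) *m y = z *: v] forces [v *m x] to be nonzero;
    multiplying by [x] on the right and cancelling [v *m x] gives [z]. *)
Lemma eigenvalue_cVrV_neq0 (F : fieldType) (n : nat) (x : 'cV[F]_n)
    (y : 'rV[F]_n) (z : F) :
  eigenvalue (x *m y) z -> z != 0 -> z = (y *m x) 0 0.
Proof.
move=> /eigenvalueP[v vxy v_neq0] z_neq0.
have vx_neq0 : (v *m x) 0 0 != 0.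
  apply: contraNneq v_neq0 => vx0; move/eqP: vxy.
  rewrite mulmxA mul11mx vx0 scale0r eq_sym.
  by rewrite scaler_eq0 (negPf z_neq0).
apply: (mulfI vx_neq0).
have /(congr1 (fun w => (w *m x) 0 0)) := vxy.
rewrite mulmxA mul11mx -!scalemxAl => vyE; rewrite mulrC.
by move: vyE; rewrite [LHS]mxE [RHS]mxE => <-.
Qed.

Lemma spectral_radius_cVrV (R : realType) (n : nat) (x : 'cV[R]_n.+2)
    (y : 'rV[R]_n.+2) : spectral_radius (x *m y) = `|(y *m x) 0 0|.
Proof.
rewrite /spectral_radius map_mxM; set E := (X in sup X).
have yxE : (map_mx (real_complex R) y *m map_mx (real_complex R) x) 0 0 =
    real_complex R ((y *m x) 0 0) by rewrite -map_mxM mxE.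
have normcR (t : R) : ComplexField.Normc.normc (real_complex R t) = `|t|.
  by rewrite /= expr0n addr0 sqrtr_sqr.
have Eyx : E `|(y *m x) 0 0|.
  exists (real_complex R ((y *m x) 0 0)); last exact: normcR.
  by rewrite /= -yxE; exact: eigenvalue_cVrV.
have ubE : ubound E `|(y *m x) 0 0|.
  move=> _ [z /= zev <-]; have [->|z_neq0] := eqVneq z 0.
    by rewrite ComplexField.Normc.normc0.
  by rewrite (eigenvalue_cVrV_neq0 zev z_neq0) yxE normcR.
apply/eqP; rewrite eq_le; apply/andP; split.
  by apply: ge_sup => //; exists `|(y *m x) 0 0|.
by apply: ub_le_sup => //; exists `|(y *m x) 0 0|.
Qed.

(** * From irreducibility to bases inside a set *)

(** Among the subspaces contained in [W] take one of maximal dimension: a vector of [W] outside it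
    could be adjoined, contradicting maximality. *)
Lemma submodule_vspace (F : fieldType) (vT : vectType F) (W : set vT) :
  W 0 -> (forall (a : F) u v, W u -> W v -> W (a *: u + v)) ->
  exists U : {vspace vT}, forall v, v \in U <-> W v.
Proof.
move=> W0 Wlin.
pose P n := `[< exists2 U : {vspace vT}, \dim U = n & forall v, v \in U -> W v >].
have exP : exists n, P n.
  exists 0%N; apply/asboolP; exists 0%VS; first exact: dimv0.
  by move=> v; rewrite memv0 => /eqP ->.
have boundP n : P n -> (n <= dim vT)%N.
  by move=> /asboolP[U <- _]; rewrite -dimvf dimvS ?subvf.
case: (ex_maxnP exP boundP) => n /asboolP[U dimU subU] maxn.
exists U => v; split; first exact: subU.
move=> Wv; apply: contrapT => /negP vU.
have : P (\dim (U + <[v]>)%VS).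
  apply/asboolP; exists (U + <[v]>)%VS => // _ /memv_addP[u Uu [_ /vlineP[a ->] ->]].
  by rewrite addrC; apply: Wlin => //; exact: subU.
move=> /maxn; rewrite -dimU leqNgt => /negP; apply.
rewrite ltn_neqAle dimvS ?addvSl // andbT.
apply: contraNN vU => /eqP dimE.
have : (U == U + <[v]>)%VS by rewrite eqEdim addvSl dimE leqnn.
by move=> /eqP ->; rewrite memvE addvSr.
Qed.

Lemma irreducible_invariantT (R : realType) (d : nat) (S : set 'M[R]_d)
    (W : set 'cV[R]_d) (w : 'cV[R]_d) :
  irreducible_family S -> W 0 ->
  (forall (a : R) u v, W u -> W v -> W (a *: u + v)) ->
  (forall A v, S A -> W v -> W (A *m v)) ->
  W w -> w != 0 -> forall v, W v.
Proof.
move=> irrS W0 Wlin WS Ww w_neq0 v.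
have [U UE] := submodule_vspace W0 Wlin.
have [|U0|UT] := irrS U.
- by move=> A u SA /UE Wu; apply/UE; exact: WS.
- by move: Ww w_neq0 => /UE; rewrite U0 memv0 => ->.
- by apply/UE; rewrite UT memvf.
Qed.

(** The basis is built greedily: fewer than [n] independent rows are killed by some nonzero [v], and
    any [y] in [Y] with [y *m v != 0] is independent of them. *)
Lemma unitmx_rows (F : fieldType) (n : nat) (Y : set 'rV[F]_n) :
  (forall v : 'cV[F]_n, (forall y, Y y -> y *m v = 0) -> v = 0) ->
  exists2 P : 'M[F]_n, P \in unitmx & forall i, Y (row i P).
Proof.
move=> Ysep.
have exP k : (k <= n)%N ->
    exists2 P : 'M[F]_(k, n), row_free P & forall i, Y (row i P).
  elim: k => [_|k IHk kn].
    by exists 0; [rewrite /row_free mxrank0|case].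
  have [P freeP YP] := IHk (ltnW kn).
  have [v v_neq0 Pv0] : exists2 v : 'cV[F]_n, v != 0 & P *m v = 0.
    have /rowV0Pn[u /sub_kermxP uP u_neq0] : kermx P^T != 0.
      by rewrite -mxrank_eq0 mxrank_ker mxrank_tr (eqP freeP) subn_eq0 -ltnNge.
    exists u^T; first by rewrite -(inj_eq trmx_inj) trmxK trmx0.
    by apply: trmx_inj; rewrite trmx_mul trmxK uP trmx0.
  have [y Yy yv_neq0] : exists2 y, Y y & y *m v != 0.
    apply: contrapT => noy; move/eqP: v_neq0; apply; apply: Ysep => y Yy.
    by apply: contrapT => yv; apply: noy; exists y => //; apply/eqP.
  exists (col_mx y P : 'M[F]_(1 + k, n)).
    apply: (@inj_row_free _ (1 + k)) => u; rewrite -[u](@hsubmxK _ _ 1 k) mul_row_col => uyP.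
    (* Multiplying the relation by [v] kills the rows of [P] and isolates the coefficient of [y]. *)
    have u0 : lsubmx u = 0.
      have /(congr1 (fun w => (w *m v) 0 0)) := uyP.
      rewrite mulmxDl -!mulmxA Pv0 mulmx0 addr0 mul0mx.
      rewrite mulmx11 [RHS]mxE mxE => /eqP.
      rewrite mulf_eq0 => /orP[yv0|/eqP lu0].
        case/eqP: yv_neq0; rewrite [y *m v]mx11_scalar (eqP yv0).
        exact: raddf0.
      by rewrite [lsubmx u]mx11_scalar lu0; exact: raddf0.
    move: uyP; rewrite u0 mul0mx add0r -[RHS](mul0mx _ P).
    by move=> /(row_free_inj freeP) ->; rewrite row_mx0.
  move=> i; case: (@split_ordP 1 k i) => j ->.
    by rewrite (rowKu j y P); have -> : row j y = y by apply/rowP=> l; rewrite mxE (ord1 j).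
  by rewrite (rowKd j y P).
have [P freeP YP] := exP n (leqnn n).
by exists P => //; rewrite -row_free_unit.
Qed.

(** Row [i] of the conjugate lists the coordinates of [row i P *m A] in the basis formed by the rows
    of [P]. *)
Lemma one_three_matrix_conj (R : realType) (P A : 'M[R]_3) :
  P \in unitmx ->
  (forall i, exists j, row i P *m A = row j P \/ row i P *m A = - row j P) ->
  one_three_matrix (P *m A *m invmx P).
Proof.
move=> Pu PA i; have [j PAj] := PA i.
have PAPE k : (P *m A *m invmx P) i k = (row i P *m A *m invmx P) 0 k.
  by rewrite -!row_mul [RHS]mxE.
have rowPE k : (row j P *m invmx P) 0 k = (j == k)%:R.
  by rewrite -row_mul mulmxV // !mxE.
exists j; [|move=> k kj]; rewrite PAPE; case: PAj => ->.
- by left; rewrite rowPE eqxx.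
- by right; rewrite mulNmx mxE rowPE eqxx.
- by rewrite rowPE eq_sym (negPf kj).
- by rewrite mulNmx mxE rowPE eq_sym (negPf kj) oppr0.
Qed.

(** * Sign vectors in dimension three *)

Definition sign_row (R : realType) (z : 'rV[R]_3) := forall i, `|z 0 i| = 1.

(* Determines a sign vector up to a global sign. *)
Definition sign_class (R : realType) (z : 'rV[R]_3) : bool * bool :=
  (z 0 0 == z 0 1, z 0 0 == z 0 2%:R).

Lemma normr1P (R : realType) (t : R) : `|t| = 1 -> t = 1 \/ t = - 1.
Proof. by move/eqP; rewrite eqr_norml ler01 andbT => /orP[]/eqP; auto. Qed.

Lemma eq_rV3 (R : realType) (u v : 'rV[R]_3) :
  u 0 0 = v 0 0 -> u 0 1 = v 0 1 -> u 0 2%:R = v 0 2%:R -> u = v.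
Proof.
move=> uv0 uv1 uv2; apply/rowP => -[[|[|[|//]]] im].
- by rewrite (_ : Ordinal im = 0) //; exact: val_inj.
- by rewrite (_ : Ordinal im = 1) //; exact: val_inj.
- by rewrite (_ : Ordinal im = 2%:R) //; exact: val_inj.
Qed.

Lemma eq_cV3 (R : realType) (u v : 'cV[R]_3) :
  u 0 0 = v 0 0 -> u 1 0 = v 1 0 -> u 2%:R 0 = v 2%:R 0 -> u = v.
Proof. by move=> *; apply: trmx_inj; apply: eq_rV3; rewrite !mxE. Qed.

Lemma sign_class_eq (R : realType) (z z' : 'rV[R]_3) :
  sign_row z -> sign_row z' -> sign_class z = sign_class z' ->
  z = z' \/ z = - z'.
Proof.
move=> sz sz' [].
have n11 : ((1 : R) == - 1) = false by apply/negbTE/eqP; lra.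
have n11' : ((- 1 : R) == 1) = false by apply/negbTE/eqP; lra.
case: (normr1P (sz 0)) (normr1P (sz 1)) (normr1P (sz 2%:R))
  (normr1P (sz' 0)) (normr1P (sz' 1)) (normr1P (sz' 2%:R))
  => e0 [] e1 [] e2 [] e3 [] e4 [] e5;
  rewrite e0 e1 e2 e3 e4 e5 ?eqxx ?n11 ?n11' // => _ _;
  first [by left; apply: eq_rV3; congruence
        |by right; apply: eq_rV3; rewrite mxE ?e0 ?e1 ?e2 ?e3 ?e4 ?e5 ?opprK].
Qed.

(** Counting: [option 'I_3] and [bool * bool] both have four elements, so the injective map to sign
    classes is onto. *)
Lemma sign_row_cover (R : realType) (z : option 'I_3 -> 'rV[R]_3) :
  (forall i, sign_row (z i)) ->
  (forall i j, i != j -> z i <> z j /\ z i <> - z j) ->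
  forall s, sign_row s -> exists i, s = z i \/ s = - z i.
Proof.
move=> sz zneq s ss.
have zinj : injective (fun i => sign_class (z i)).
  move=> i j zij; apply/eqP; case: eqVneq => // /zneq[? ?].
  by case: (sign_class_eq (sz i) (sz j) zij).
have /(_ (sign_class s)) /codomP[i si] :
    forall b, b \in codom (fun i => sign_class (z i)).
  by apply: inj_card_onto => //; rewrite card_option card_prod card_bool card_ord.
by exists i; exact: sign_class_eq.
Qed.

(** The four sign vectors with first entry 1 suffice: if all the numbers [a0 + s * a1 + t * a2] with
    signs [s], [t] are 1 or -1, linear arithmetic leaves only signed unit vectors. *)
Lemma sign_row_dual (R : realType) (a : 'cV[R]_3) :
  (forall z, sign_row z -> `|(z *m a) 0 0| = 1) ->
  exists i, a = delta_mx i 0 \/ a = - delta_mx i 0.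
Proof.
move=> Ha.
pose z (s t : R) : 'rV[R]_3 := \row_i [:: 1; s; t]`_i.
have sz s t : `|s| = 1 -> `|t| = 1 -> sign_row (z s t).
  by move=> hs ht [[|[|[|//]]] im]; rewrite mxE /= ?normr1.
have zE s t : (z s t *m a) 0 0 = a 0 0 + s * a 1 0 + t * a 2%:R 0.
  rewrite mxE !big_ord_recl big_ord0 !mxE /= mul1r addr0 addrA.
  by congr (_ + _ * a _ _ + _ * a _ _); exact: val_inj.
have n1 : `|1 : R| = 1 by rewrite normr1.
have nN1 : `|- 1 : R| = 1 by rewrite normrN1.
have := Ha _ (sz 1 1 n1 n1); have := Ha _ (sz 1 (-1) n1 nN1).
have := Ha _ (sz (-1) 1 nN1 n1); have := Ha _ (sz (-1) (-1) nN1 nN1).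
rewrite !zE => /normr1P h1 /normr1P h2 /normr1P h3 /normr1P h4.
have [[a0 [a1 a2]]|[[a0 [a1 a2]]|[a0 [a1 a2]]]] :
    ((a 0 0 = 1 \/ a 0 0 = - 1) /\ a 1 0 = 0 /\ a 2%:R 0 = 0) \/
    ((a 1 0 = 1 \/ a 1 0 = - 1) /\ a 0 0 = 0 /\ a 2%:R 0 = 0) \/
    ((a 2%:R 0 = 1 \/ a 2%:R 0 = - 1) /\ a 0 0 = 0 /\ a 1 0 = 0).
- move: h1 h2 h3 h4 => [] h1 [] h2 [] h3 [] h4;
  first [by exfalso; lra
        |by left; split; [first [left; lra|right; lra]|split; lra]
        |by right; left; split; [first [left; lra|right; lra]|split; lra]
        |by right; right; split; [first [left; lra|right; lra]|split; lra]].
- exists 0; case: a0 => a0; [left|right]; apply: eq_cV3; rewrite !mxE ?a0 ?a1 ?a2 //=; lra.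
- exists 1; case: a0 => a0; [left|right]; apply: eq_cV3; rewrite !mxE ?a0 ?a1 ?a2 //=; lra.
- exists 2%:R; case: a0 => a0; [left|right]; apply: eq_cV3; rewrite !mxE ?a0 ?a1 ?a2 //=; lra.
Qed.

Theorem proposition9 (R : realType) (S : set 'M[R]_3)
    (semigroupS : matrix_semigroup S)
    (csrS : constant_spectral_radius S)
    (irrS : irreducible_family S)
    (rankS : minimal_rank S 1) :
  exists2 T : 'M[R]_3, T \in unitmx &
    (forall A, S A -> one_three_matrix (invmx T *m A *m T)) \/
    (forall A, S A -> one_three_matrix (invmx T *m A *m T)^T).
Proof.
have [_ SM] := semigroupS; have [r r_neq0 Sr] := csrS.
have [[A0 SA0 /mulmx_rank1[x0 [y0 A0E]]] _] := rankS.
have {A0E} Sxy0 : S (x0 *m y0) by rewrite -A0E.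
have r1 : r = 1.
  apply: (mulfI r_neq0); rewrite mulr1 -{3}(Sr _ (SM _ _ Sxy0 Sxy0)).
  rewrite mulmx_cVrV_cVrV spectral_radius_cVrV -scalemxAr mxE normrM.
  by rewrite -(spectral_radius_cVrV x0) (Sr _ Sxy0).
pose X : set 'cV[R]_3 := [set x | S (x *m y0)].
pose Y : set 'rV[R]_3 := [set y | S (x0 *m y)].
have SX A x : S A -> X x -> X (A *m x) by rewrite /X /= -mulmxA; exact: SM.
have SY A y : S A -> Y y -> Y (y *m A).
  by rewrite /Y /= mulmxA => SA Sy; exact: SM.
(* The product of [x *m y0] and [x0 *m y] is a multiple of [x *m y] by the scalar [y0 *m x0], whose
   modulus is already 1. *)
have XY x y : X x -> Y y -> `|(y *m x) 0 0| = 1.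
  move=> Xx Yy; have := Sr _ (SM _ _ Xx Yy).
  rewrite mulmx_cVrV_cVrV spectral_radius_cVrV -scalemxAr mxE normrM r1.
  by rewrite -(spectral_radius_cVrV x0) (Sr _ Sxy0) r1 mul1r.
have yx0_neq0 : y0 *m x0 != 0.
  apply: contra_eqN (XY x0 y0 Sxy0 Sxy0) => /eqP ->.
  by rewrite mxE normr0 eq_sym oner_eq0.
have x0_neq0 : x0 != 0 by apply: contraNneq yx0_neq0 => ->; rewrite mulmx0.
have [P Pu YP] : exists2 P : 'M[R]_3, P \in unitmx & forall i, Y (row i P).
  (* The common kernel of [Y] is invariant under [S]; were it nonzero, it would contain [x0],
     against [y0 *m x0 != 0]. *)
  apply: unitmx_rows => v Yv; apply: contrapT => /eqP v_neq0.
  suff /(_ x0 y0 Sxy0) yx0 : forall (w : 'cV[R]_3) y, Y y -> y *m w = 0.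
    by rewrite yx0 eqxx in yx0_neq0.
  apply: (irreducible_invariantT irrS (W := fun w => forall y, Y y -> y *m w = 0)
            _ _ _ Yv v_neq0).
  - by move=> y _; rewrite mulmx0.
  - move=> a u w Wu Ww y Yy.
    by rewrite mulmxDr -scalemxAr Wu // Ww // scaler0 addr0.
  - by move=> A w SA Ww y Yy; rewrite mulmxA Ww //; exact: SY.
have [Qt Qtu XQt] : exists2 Q : 'M[R]_3, Q \in unitmx &
    forall i, X (row i Q)^T.
  apply: (unitmx_rows (Y := [set x | X x^T])) => u Xu.
  (* The second clause makes [W] invariant under [S]; the first must be stated separately, as [S]
     may lack the identity. [W] contains [x0] because [X] is stable under [S]. *)
  pose W := [set w : 'cV[R]_3 | u^T *m w = 0 /\
                                forall A, S A -> u^T *m (A *m w) = 0].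
  have Xu' x : X x -> u^T *m x = 0.
    move=> Xx; apply: trmx_inj; rewrite trmx_mul trmxK trmx0.
    by apply: Xu; rewrite /= trmxK.
  have WT : forall w, W w.
    apply: (irreducible_invariantT irrS _ _ _ _ x0_neq0).
    - by split=> [|A _]; rewrite ?mulmx0.
    - move=> a v w [v1 v2] [w1 w2]; split=> [|A SA].
        by rewrite mulmxDr -scalemxAr v1 w1 scaler0 addr0.
      by rewrite !mulmxDr -!scalemxAr v2 // w2 // scaler0 addr0.
    - move=> A w SA [_ w2]; split=> [|B SB]; first exact: w2.
      by rewrite (mulmxA B); apply: w2; exact: SM.
    - by split=> [|A SA]; apply: Xu' => //; exact: SX.
  apply: trmx_inj; rewrite trmx0; apply/rowP => i.
  have [/(congr1 (fun M : 'M[R]_1 => M 0 0)) + _] := WT (delta_mx i 0).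
  by rewrite -colE !mxE.
pose Q := Qt^T.
have Qu : Q \in unitmx by rewrite unitmx_tr.
have XQ i : X (col i Q) by rewrite -[col i Q]trmxK tr_col trmxK; exact: XQt.
have [Yfew|] := pselect (forall y, Y y -> exists i, y = row i P \/ y = - row i P).
  exists (invmx P); first by rewrite unitmx_inv.
  left=> A SA; rewrite invmxK; apply: one_three_matrix_conj => // i.
  by apply: Yfew; exact: SY.
move=> /existsNP[y4 /not_implyP[Yy4 /forallNP y4P]].
(* Four elements of [Y], pairwise distinct up to sign: the basis and, at [None], the extra vector
   [y4]. *)
pose y (o : option 'I_3) := if o is Some i then row i P else y4.
have Yy o : Y (y o) by case: o.
have y_neq i j : i != j -> y i <> y j /\ y i <> - y j.
  case: i j => [i|] [j|] //= ij; last 2 first.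
  - have /not_orP[yj yNj] := y4P i; split=> [e|e]; first exact: yj.
    by apply: yNj; rewrite e opprK.
  - by have /not_orP[] := y4P j.
  have rowP k l : (row k P *m invmx P) 0 l = (k == l)%:R.
    by rewrite -row_mul mulmxV // !mxE.
  have {}ij : i != j by apply: contraNneq ij => ->.
  split=> /(congr1 (fun w => (w *m invmx P) 0 i)) /=.
    by rewrite !rowP eqxx eq_sym (negPf ij) => /eqP; rewrite oner_eq0.
  rewrite mulNmx [(- (_ *m _)) 0 i]mxE !rowP eqxx eq_sym (negPf ij) oppr0.
  move=> /eqP.
  by rewrite oner_eq0.
have yQ_inj : injective (fun w : 'rV[R]_3 => w *m Q).
  by apply: row_free_inj; rewrite row_free_unit.
have yQ_sign o : sign_row (y o *m Q).
  (* The entries of [y o *m Q] are the pairings of [y o] with the columns of [Q], which lie in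
     [X]. *)
  by move=> k; have := XY _ _ (XQ k) (Yy o); rewrite colE mulmxA -colE mxE.
have yQ_neq i j : i != j -> y i *m Q <> y j *m Q /\ y i *m Q <> - (y j *m Q).
  by move=> /y_neq[yij yNij]; rewrite -mulNmx; split=> /yQ_inj.
have Xfew x : X x -> exists i, x = col i Q \/ x = - col i Q.
  move=> Xx; have [|i aE] := @sign_row_dual R (invmx Q *m x).
    move=> z /(sign_row_cover yQ_sign yQ_neq)[i zE].
    rewrite -(XY x (y i) Xx (Yy i)).
    case: zE => ->; first by rewrite mulmxA mulmxK.
    by rewrite mulNmx mulmxA mulmxK // [(- (_ *m _)) 0 0]mxE normrN.
  exists i; rewrite colE -[x](mulKVmx Qu).
  by case: aE => ->; rewrite ?mulmxN; [left|right].
exists Q => //; right=> A SA.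
(* Transposing turns the columns of [Q] into the rows of [Q^T], so the row criterion applies to
   [A^T]. *)
rewrite !trmx_mul mulmxA trmx_inv.
apply: one_three_matrix_conj; first by rewrite unitmx_tr.
move=> i; have [j Acol] := Xfew _ (SX _ _ SA (XQ i)); exists j.
rewrite -!tr_col -trmx_mul -raddfN.
by case: Acol => ->; [left|right].
Qed.
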